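(* Let $A=(A,\oplus,\odot)$ be a two-sided skew brace with additive group $A_{\oplus}$ and multiplicative group $A_{\odot}$. If $A_{\odot}$ is nilpotent of nilpotency class $k$, then $A_{\oplus}$ is solvable of class at most $2k$.
   Context: A skew brace $A=(A,\oplus,\odot)$ is a set with two binary operations $\oplus,\odot$ such that $A_{\oplus}=(A,\oplus)$ (the additive group, not necessarily abelian) and $A_{\odot}=(A,\odot)$ (the multiplicative group) are groups and $a\odot(b\oplus c)=(a\odot b)\ominus a\oplus(a\odot c)$ for all $a,b,c\in A$. Here $\ominus a$ denotes the inverse of $a$ in $A_{\oplus}$, and $x\ominus y$ means $x\oplus(\ominus y)$. A skew brace $A$ is two-sided if in addition $(a\oplus b)\odot c=(a\odot c)\ominus c\oplus(b\odot c)$ for all $a,b,c\in A$. ''Solvable of class at most $m$'' means solvable with derived length at most $m$. *)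

(* Defs.v *)
From HB Require Import structures.
From mathcomp Require Import all_boot.
From mathcomp Require Import classical_sets.

Set Implicit Arguments.
Unset Strict Implicit.
Unset Printing Implicit Defensive.

Import Algebra.

Local Open Scope classical_set_scope.
Local Open Scope group_scope.

Section Series.
Variable G : groupType.
Implicit Types H K : set G.

Definition subgroup H : Prop :=
  [/\ H 1, (forall x y, H x -> H y -> H (x * y))
    & forall x, H x -> H x^-1].

Definition commutator H K : set G :=
  smallest subgroup [set [~ x, y] | x in H & y in K].

(* Indexed from 0: [lower_central i] is the term usually written gamma_(i+1). *)
Fixpoint lower_central (i : nat) : set G :=
  if i is j.+1 then commutator (lower_central j) setT else setT.

Fixpoint derived (i : nat) : set G :=
  if i is j.+1 then commutator (derived j) (derived j) else setT.

End Series.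
Arguments lower_central : clear implicits.
Arguments derived : clear implicits.

Definition nilpotent_of_class (G : groupType) (k : nat) : Prop :=
  lower_central G k = [set 1] /\
  forall j, (j < k)%N -> lower_central G j <> [set 1].

Definition solvable_of_length (G : groupType) (d : nat) : Prop :=
  derived G d = [set 1] /\
  forall j, (j < d)%N -> derived G j <> [set 1].

Definition solvable_of_class_at_most (G : groupType) (m : nat) : Prop :=
  exists2 d, solvable_of_length G d & (d <= m)%N.

(* The two neutral elements are kept apart: that they coincide is a
   consequence of the axioms. *)
HB.mixin Record isSkewBrace A of Choice A := {
  sadd : A -> A -> A;
  szero : A;
  sopp : A -> A;
  saddA : associative sadd;
  sadd0r : left_id szero sadd;
  saddr0 : right_id szero sadd;
  saddNr : left_inverse szero sopp sadd;
  saddrN : right_inverse szero sopp sadd;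
  smul : A -> A -> A;
  sone : A;
  sinv : A -> A;
  smulA : associative smul;
  smul1r : left_id sone smul;
  smulr1 : right_id sone smul;
  smulVr : left_inverse sone sinv smul;
  smulrV : right_inverse sone sinv smul;
  smulDr : forall a b c : A,
    smul a (sadd b c) = sadd (sadd (smul a b) (sopp a)) (smul a c)
}.

#[short(type="skewBraceType")]
HB.structure Definition SkewBrace := {A of isSkewBrace A & Choice A}.

Declare Scope brace_scope.
Delimit Scope brace_scope with brace.
Notation "a ⊕ b" := (sadd a b) (at level 50, left associativity) : brace_scope.
Notation "⊖ a" := (sopp a) (at level 35, right associativity) : brace_scope.
Notation "a ⊖ b" := (sadd a (sopp b))
  (at level 50, left associativity) : brace_scope.
Notation "a ⊙ b" := (smul a b) (at level 40, left associativity) : brace_scope.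

(* Aliases of the carrier, so that each of the two groups gets its own
   [groupType] instance. *)
Definition additive_group (A : skewBraceType) : Type := A.
Definition multiplicative_group (A : skewBraceType) : Type := A.

HB.instance Definition _ (A : skewBraceType) :=
  Choice.on (additive_group A).
HB.instance Definition _ (A : skewBraceType) :=
  isGroup.Build (additive_group A)
    (@saddA A) (@sadd0r A) (@saddr0 A) (@saddNr A) (@saddrN A).

HB.instance Definition _ (A : skewBraceType) :=
  Choice.on (multiplicative_group A).
HB.instance Definition _ (A : skewBraceType) :=
  isGroup.Build (multiplicative_group A)
    (@smulA A) (@smul1r A) (@smulr1 A) (@smulVr A) (@smulrV A).

Definition two_sided (A : skewBraceType) : Prop :=
  forall a b c : A, ((a ⊕ b) ⊙ c = (a ⊙ c) ⊖ c ⊕ (b ⊙ c))%brace.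

(* Main.v *)
Require Import Defs.
From mathcomp Require Import all_boot.
From mathcomp Require Import boolp classical_sets.

(** In a skew brace, the elements [⊖ a ⊕ a ⊙ d ⊖ d] measure how far [⊙] is
    from [⊕], and the elements [⊖ c ⊕ b ⊙ c ⊖ b] measure how far [⊙] is from
    the opposite of [⊕].  When the brace is two-sided, [(a ⊕ b) ⊙ (c ⊕ d)] can
    be expanded on the left first or on the right first; comparing the two
    results shows that every element of the first kind commutes additively with
    every element of the second kind ([defects_commute]).

    Let [N] be the additive centralizer of the elements of the second kind, and
    let [N'] be the centralizer of [N].  Two-sidedness makes a conjugate of an
    element of the second kind a difference of two such elements
    ([opposite_defect_conj]), hence [N] and [N'] are normal.  Now [N] contains
    the elements of the first kind, so the identity induces a surjective
    homomorphism from the multiplicative group onto the additive group modulo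
    [N]; and [N'] contains the elements of the second kind, so the identity is an
    antihomomorphism modulo [N'], and [x |-> x^-1] (inverse for [⊙]) induces a
    surjective homomorphism onto the additive group modulo [N'].  Both
    quotients therefore inherit class at most [k] from the multiplicative group,
    and their [k]-th derived subgroups vanish ([derived_sub_quotient]).  Thus the
    [k]-th derived subgroup of the additive group lies in the intersection of
    [N] and [N'], which is abelian because [N'] centralizes [N].  The derived
    length is then at most [k + 1], which is at most [2k] as soon as [k > 0]; if
    [k = 0] the brace is trivial. *)

Set Implicit Arguments.
Unset Strict Implicit.
Unset Printing Implicit Defensive.

Import Algebra.

Local Open Scope classical_set_scope.
Local Open Scope group_scope.

Ltac gnorm := rewrite /commg /conjg
  ?(invgM, invgK, invg1, mulg1, mul1g, mulgA, mulgK, mulgVK, mulVg, mulgV).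

(** * Normal subgroups, centralizers and derived series *)

Definition normal_subgroup (G : groupType) (N : set G) : Prop :=
  subgroup N /\ forall x y, N x -> N (x ^ y).

Definition centralizer (G : groupType) (S : set G) : set G :=
  [set x | forall s, S s -> commute x s].

Definition eqmod (G : groupType) (N : set G) (x y : G) : Prop := N (x^-1 * y).

(** The hypothesis puts the conjugates of elements of [S] in the subgroup
    generated by [S]; so this subgroup is normal, and it has the same centralizer
    as [S]. *)
Lemma centralizer_normal (G : groupType) (S : set G) :
  (forall x y, S x -> exists s t, [/\ S s, S t & x ^ y = s^-1 * t]) ->
  normal_subgroup (centralizer S).
Proof.
move=> SJ; split; first split.
- by move=> s _; apply/commute_sym/commute1.
- move=> x y Cx Cy s Ss; apply/commute_sym/commuteM.
    exact/commute_sym/Cx.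
  exact/commute_sym/Cy.
- by move=> x Cx s Ss; apply/commute_sym/commuteV/commute_sym/Cx.
move=> x y Cx s Ss.
have [u [v [Su Sv sy]]] := SJ s y^-1 Ss.
have : commute x (s ^ y^-1).
  by rewrite sy; apply: commuteM; [apply/commuteV/Cx | apply: Cx].
move=> /(congr1 (fun z => z ^ y)).
by rewrite 2!conjMg conjgKV.
Qed.

Lemma centralizer_of_normal (G : groupType) (N : set G) :
  normal_subgroup N -> normal_subgroup (centralizer N).
Proof.
move=> [[N1 _ _] NJ]; apply: centralizer_normal => x y Nx.
by exists 1, (x ^ y); split=> //; [apply: NJ | rewrite invg1 mul1g].
Qed.

Section Congruence.
Variables (G : groupType) (N : set G).
Hypothesis normN : normal_subgroup N.

Lemma eqmod_refl x : eqmod N x x.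
Proof. by case: normN => -[N1 _ _] _; rewrite /eqmod mulVg. Qed.

Lemma eqmod_sym x y : eqmod N x y -> eqmod N y x.
Proof. by case: normN => -[_ _ NV] _ /NV; rewrite /eqmod invgM invgK. Qed.

Lemma eqmod_trans y x z : eqmod N x y -> eqmod N y z -> eqmod N x z.
Proof.
case: normN => -[_ NM _] _ xy yz.
by have := NM _ _ xy yz; rewrite /eqmod; gnorm.
Qed.

Lemma eqmodM x y x' y' :
  eqmod N x x' -> eqmod N y y' -> eqmod N (x * y) (x' * y').
Proof.
case: normN => -[_ NM _] NJ xx' yy'.
by have := NM _ _ (NJ _ y xx') yy'; rewrite /eqmod; gnorm.
Qed.

Lemma eqmodV x y : eqmod N x y -> eqmod N x^-1 y^-1.
Proof.
case: normN => _ NJ /eqmod_sym xy.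
by have := NJ _ y^-1 xy; rewrite /eqmod; gnorm.
Qed.

Lemma eqmodR x y x' y' :
  eqmod N x x' -> eqmod N y y' -> eqmod N [~ x, y] [~ x', y'].
Proof.
by move=> xx' yy'; apply: eqmodM; [exact: eqmodV |
  apply: eqmodM; [exact: eqmodV | exact: eqmodM]].
Qed.

End Congruence.

Lemma lower_central_subgroup (G : groupType) i : subgroup (lower_central G i).
Proof.
case: i => [|i]; first by split.
split=> [H [[]] //|x y Hx Hy H HH|x Hx H HH].
- by case: (HH) => -[_ HM _] _; apply: HM; [apply: Hx | apply: Hy].
- by case: (HH) => -[_ _ HV] _; apply: HV; apply: Hx.
Qed.

(** The map [f] stands for a surjective homomorphism from [G] to [H / N]: it
    carries the lower central series of [G] onto that of [H / N], which contains
    the derived series of [H / N]. *)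
Lemma derived_sub_quotient (G H : groupType) (N : set H) (f : G -> H) k :
  normal_subgroup N ->
  (forall x y, eqmod N (f x * f y) (f (x * y))) ->
  (forall h, exists g, f g = h) ->
  lower_central G k = [set 1] ->
  derived H k `<=` N.
Proof.
move=> nN fM fsurj Gk.
have f1 : eqmod N 1 (f 1).
  have := eqmodM nN (eqmod_refl nN (f 1)^-1) (fM 1 1).
  by rewrite mulg1 mulKg mulVg => /(eqmod_sym nN).
have fV x : eqmod N (f x)^-1 (f x^-1).
  have := fM x x^-1; rewrite mulgV => /(eqmod_trans nN) /(_ (eqmod_sym nN f1)).
  move=> /(eqmodM nN (eqmod_refl nN (f x)^-1)).
  by rewrite mulKg mulg1 => /(eqmod_sym nN).
have fR x y : eqmod N [~ f x, f y] (f [~ x, y]).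
  apply: (eqmod_trans nN) (fM _ _); apply: eqmodM => //.
  apply: (eqmod_trans nN) (fM _ _); apply: eqmodM => //.
pose L i := [set h | exists2 g, lower_central G i g & eqmod N h (f g)].
have dL i : derived H i `<=` L i.
  elim: i => [h _|i IHi].
    by have [g <-] := fsurj h; exists g => //; apply: eqmod_refl.
  apply: smallest_sub.
    have [G1 GM GV] := lower_central_subgroup G i.+1; split.
    - by exists 1.
    - move=> x y [g Gg xg] [g' Gg' yg']; exists (g * g'); first exact: GM.
      by apply: (eqmod_trans nN) (fM _ _); apply: eqmodM.
    - move=> x [g Gg xg]; exists g^-1; first exact: GV.
      by apply: (eqmod_trans nN) (fV _); apply: eqmodV.
  move=> _ [x dx [y dy <-]].
  have [g Gg xg] := IHi x dx; have [g' _ yg'] := IHi y dy.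
  exists [~ g, g'].
    by apply: sub_gen_smallest; exists g => //; exists g'.
  by apply: (eqmod_trans nN) (fR _ _); apply: eqmodR.
move=> h /dL[g]; rewrite Gk => -> hf1.
have /= := eqmod_sym nN (eqmod_trans nN hf1 (eqmod_sym nN f1)).
by rewrite /eqmod invg1 mul1g.
Qed.

Lemma derived_abelian (G : groupType) k :
  (forall x y, derived G k x -> derived G k y -> commute x y) ->
  derived G k.+1 = [set 1].
Proof.
move=> abel; apply/seteqP; split; last by move=> _ -> H [[]].
apply: smallest_sub; first split => //.
- by move=> x y -> ->; rewrite mulg1.
- by move=> x ->; rewrite invg1.
move=> _ [x dx [y dy <-]].
by apply/eqP/commgP; apply: abel.
Qed.

Lemma solvable_of_derived (G : groupType) m :
  derived G m = [set 1] -> solvable_of_class_at_most G m.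
Proof.
move=> Gm; have exd : exists d, `[< derived G d = [set 1] >].
  by exists m; apply/asboolP.
case: (ex_minnP exd) => d /asboolP Gd dmin.
exists d; last by apply: dmin; apply/asboolP.
by split=> // j jd /asboolP /dmin; rewrite leqNgt jd.
Qed.

(** * The two defects of a two-sided skew brace *)

Section Brace.
Variable A : skewBraceType.
(* For elements of [G], [*] and [^-1] denote the additive operations. *)
Local Notation G := (additive_group A).
Local Notation "x ⊙ y" := (@smul A x y : additive_group A)
  (at level 40, left associativity).

Definition defect (a d : G) : G := a^-1 * (a ⊙ d) * d^-1.

Definition opposite_defect (b c : G) : G := c^-1 * (b ⊙ c) * b^-1.

Definition opposite_defects : set G :=
  [set x | exists b c, x = opposite_defect b c].

Lemma mul_distl (a b c : G) : a ⊙ (b * c) = a ⊙ b * a^-1 * (a ⊙ c).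
Proof. exact: smulDr. Qed.

Lemma one_zero : (sone : A) = szero.
Proof.
have := mul_distl (sone : A) 1 1.
rewrite mulg1 /= !smul1r mul1g mulg1 => /(congr1 (fun x : G => x^-1)).
by rewrite invgK invg1.
Qed.

Hypothesis A2 : two_sided A.

Lemma mul_distr (a b c : G) : (a * b) ⊙ c = a ⊙ c * c^-1 * (b ⊙ c).
Proof. exact: A2. Qed.

(** Both sides come from [(a ⊕ b) ⊙ (c ⊕ d)], after cancelling the common
    outer terms [a ⊙ c] and [b ⊙ d]. *)
Lemma defects_commute (a b c d : G) :
  commute (defect a d) (opposite_defect b c).
Proof.
have E : (a ⊙ c * c^-1 * (b ⊙ c)) * (a * b)^-1 * (a ⊙ d * d^-1 * (b ⊙ d))
       = (a ⊙ c * a^-1 * (a ⊙ d)) * (c * d)^-1 * (b ⊙ c * b^-1 * (b ⊙ d)).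
  by rewrite -!mul_distr -!mul_distl -mul_distr.
have := congr1 (fun x => (a ⊙ c)^-1 * x * (b ⊙ d)^-1) E.
by rewrite /commute /defect /opposite_defect; gnorm => ->.
Qed.

(** Expand [(y^-1 ⊕ b) ⊙ c], with [y^-1] the additive inverse. *)
Lemma opposite_defect_conj (b c y : G) :
  opposite_defect b c ^ y =
  (opposite_defect y^-1 c)^-1 * opposite_defect (y^-1 * b) c.
Proof. by rewrite /opposite_defect mul_distr; gnorm. Qed.

Lemma centralizer_opposite_defects_normal :
  normal_subgroup (centralizer opposite_defects).
Proof.
apply: centralizer_normal => _ y [b [c ->]].
exists (opposite_defect y^-1 c), (opposite_defect (y^-1 * b) c).
split; [by exists y^-1, c | by exists (y^-1 * b), c|].
exact: opposite_defect_conj.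
Qed.

(** The additive group is an extension, by an abelian group, of a subgroup of a
    product of two quotients of the multiplicative group. *)
Lemma additive_derivedS k :
  lower_central (multiplicative_group A) k = [set 1] ->
  derived (additive_group A) k.+1 = [set 1].
Proof.
move=> Ak.
pose N := centralizer opposite_defects; pose N' := centralizer N.
have nN : normal_subgroup N := centralizer_opposite_defects_normal.
have nN' : normal_subgroup N' := centralizer_of_normal nN.
have Nk : derived G k `<=` N.
  apply: (derived_sub_quotient (f := fun x : multiplicative_group A => x : G)
    nN _ _ Ak); last by move=> h; exists h.
  change (forall a d : G, N ((a * d)^-1 * (a ⊙ d))) => a d.
  have -> : (a * d)^-1 * (a ⊙ d) = defect a d ^ d.
    by rewrite /defect; gnorm.
  by apply: nN.2 => _ [b [c ->]]; apply: defects_commute.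
have N'k : derived G k `<=` N'.
  apply: (derived_sub_quotient
    (f := fun x : multiplicative_group A => x^-1 : G) nN' _ _ Ak); last first.
    move=> h; exists (h : multiplicative_group A)^-1.
    exact: (@invgK (multiplicative_group A)).
  move=> b c; rewrite /eqmod (invgM b c).
  set b' : G := (b^-1 : multiplicative_group A).
  set c' : G := (c^-1 : multiplicative_group A).
  have -> : (b' * c')^-1 * (c' ⊙ b') = opposite_defect c' b' ^ c'.
    by rewrite /opposite_defect; gnorm.
  apply: nN'.2 => x Nx; apply/commute_sym/Nx.
  by exists c', b'.
by apply: derived_abelian => x y /Nk Nx /N'k N'y; apply/commute_sym/N'y.
Qed.

End Brace.

Theorem theorem4p6 (A : skewBraceType) (k : nat) :
  two_sided A ->
  nilpotent_of_class (multiplicative_group A) k ->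
  solvable_of_class_at_most (additive_group A) (2 * k).
Proof.
move=> A2 [Ak _].
case: k Ak => [|k] Ak.
  apply: solvable_of_derived; apply/seteqP; split=> // x _.
  have : (setT : set (multiplicative_group A)) x by [].
  by rewrite [setT]Ak => ->; apply: one_zero.
have [d dP dk] := solvable_of_derived (additive_derivedS A2 Ak).
exists d => //; apply: leq_trans dk _.
by rewrite mul2n -addnn addSn ltnS leq_addl.
Qed.
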